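(* Let $n,s\ge1$ be integers, let $q_n=x_1^2+\cdots+x_n^2$, and let $T_{n,s}=\binom{s+n-1}{s}$. Every tight decomposition $$q_n^s=\sum_{k=1}^{T_{n,s}}(\mathbf{a}_k\cdot\mathbf{x})^{2s},\qquad \mathbf{a}_1,\dots,\mathbf{a}_{T_{n,s}}\in\mathbb{C}^n,$$ is first caliber. In particular, $$(\mathbf{a}_k\cdot\mathbf{a}_k)^{s}=\frac{1}{T_{n,s}}\prod_{j=0}^{s-1}\frac{2j+n}{2j+1}$$ for every $k=1,\dots,T_{n,s}$.
   Context: For $\mathbf{a},\mathbf{b}\in\mathbb{C}^n$, $\mathbf{a}\cdot\mathbf{b}=\sum_i a_ib_i$ (bilinear, not Hermitian), and $\mathbf{a}\cdot\mathbf{x}=a_1x_1+\cdots+a_nx_n$. A decomposition of $q_n^s$ of size $m$ is an identity $q_n^s=\sum_{k=1}^m(\mathbf{a}_k\cdot\mathbf{x})^{2s}$ in $\mathbb{C}[x_1,\dots,x_n]$ with $\mathbf{a}_k\in\mathbb{C}^n$. It is tight if $m=T_{n,s}$. It is first caliber if $(\mathbf{a}_k\cdot\mathbf{a}_k)^s$ takes the same value for all $k=1,\dots,m$. *)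

(* Defs.v *)
From HB Require Import structures.
From mathcomp Require Import all_boot all_order all_algebra.
From mathcomp Require Import complex mpoly.
From mathcomp Require Import reals.

Set Implicit Arguments.
Unset Strict Implicit.
Unset Printing Implicit Defensive.

Import GRing.Theory.
Local Open Scope ring_scope.

(* The form is bilinear, not Hermitian: no conjugation, also for K = R[i]. *)
Definition dot (K : comNzRingType) (n : nat) (a b : 'rV[K]_n) : K :=
  \sum_(i < n) a 0 i * b 0 i.

Definition linform (K : comNzRingType) (n : nat) (a : 'rV[K]_n) : {mpoly K[n]} :=
  \sum_(i < n) a 0 i *: 'X_i.

Definition qform (K : comNzRingType) (n : nat) : {mpoly K[n]} :=
  \sum_(i < n) 'X_i ^+ 2.

Definition decomposition (K : comNzRingType) (n s m : nat)
    (a : 'I_m -> 'rV[K]_n) : Prop :=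
  qform K n ^+ s = \sum_(k < m) linform (a k) ^+ (2 * s).

Definition Tnum (n s : nat) : nat := 'C(s + n - 1, s).

Definition tight_decomposition (K : comNzRingType) (n s m : nat)
    (a : 'I_m -> 'rV[K]_n) : Prop :=
  decomposition s a /\ m = Tnum n s.

Definition first_caliber (K : comNzRingType) (n s m : nat)
    (a : 'I_m -> 'rV[K]_n) : Prop :=
  forall k l : 'I_m, dot (a k) (a k) ^+ s = dot (a l) (a l) ^+ s.

(* Main.v *)
Require Import Defs.
From HB Require Import structures.
From mathcomp Require Import all_boot all_order all_algebra.
From mathcomp Require Import complex mpoly.
From mathcomp Require Import reals.
From mathcomp Require Import ring zify.
Import GRing.Theory Num.Theory.
Local Open Scope ring_scope.

Set Implicit Arguments.
Unset Strict Implicit.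
Unset Printing Implicit Defensive.

(** Write q for the quadratic form and a_k for the vectors of the decomposition.

    The idea is that the zonal kernel (x.y)^s has an expansion
      (x.y)^s = sum_k (a_k.x)^s P(y, a_k)
    in which P is built from q(y), q(z) and y.z only, so that P(y, y) = c q(y)^s
    for a single constant c.  When the decomposition is tight, P is the Lagrange
    kernel of the points a_k, hence P(a_l, a_l) = 1 and c q(a_l)^s = 1 for
    every l.

    To get the expansion, apply the j-th power of the Laplacian to the
    decomposition ([moments]): the sum of q(a_k)^j (a_k.x)^(2(s-j)) is a nonzero
    multiple of q^(s-j).  Restrict this to the line x + u y and compare the
    coefficients of u^(s-2j) ([zonal_relation]).  One side is
      sum_k (a_k.x)^s q(a_k)^j (a_k.y)^(s-2j),
    an expansion of the desired kind after multiplication by q(y)^j; the other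
    is a combination of the monomials (x.y)^(s-2i) (q(x) q(y))^i with i >= j, in
    which i = j has a nonzero coefficient.  This triangular system is solved
    from the largest j downwards ([zonal_monomialP]).

    Reading the expansion of (x.y)^s as an identity between forms in x and
    differentiating along a monomial shows that f(y) = sum_k f(a_k) P(y, a_k)
    for all forms f of degree s ([monomial_reproduction]).  Hence a form vanishing
    at all the a_k is zero.  As there are exactly as many points as monomials of
    degree s, every vector of values at the a_k is then attained; the form equal
    to 1 at a_l and 0 at the other points gives P(a_l, a_l) = 1
    ([tight_diagonal]).

    The common value of q(a_k)^s is found from the moment of order j = s, which
    evaluates the sum of all q(a_k)^s. *)

(** * Laplacians of powers and moments of a decomposition *)

Definition laplacian (K : comNzRingType) n (p : {mpoly K[n]}) : {mpoly K[n]} :=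
  \sum_(i < n) p^`M(i)^`M(i).

Section Laplacian.
Variables (K : comNzRingType) (n : nat).
Implicit Types (p : {mpoly K[n]}) (a : 'rV[K]_n).

Lemma mderiv_exp i p k : (p ^+ k.+1)^`M(i) = k.+1%:R * p ^+ k * p^`M(i).
Proof.
elim: k => [|k IHk]; first by rewrite expr1 expr0 !mul1r.
by rewrite exprS mderivM IHk -[k.+2]add1n natrD (exprS p k); ring.
Qed.

Lemma mderiv_var (i j : 'I_n) : ('X_j : {mpoly K[n]})^`M(i) = (j == i)%:R.
Proof.
rewrite mderivX mnm1E; case: eqP => [->|_]; last by rewrite scale0r.
rewrite scale1r (_ : (_ - _)%MM = 0%MM) ?mpolyX0 //.
by apply/mnmP => k; rewrite mnmBE subnn mnm0E.
Qed.

Lemma mderiv_linform i a : (linform a)^`M(i) = (a 0 i)%:MP.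
Proof.
rewrite /linform raddf_sum /= (bigD1 i) //= big1 => [|j ne_ji].
  by rewrite mderivZ mderiv_var eqxx addr0 -mul_mpolyC mulr1.
by rewrite mderivZ mderiv_var (negPf ne_ji) scaler0.
Qed.

Lemma mderiv_qform i : (qform K n)^`M(i) = 2%:R * 'X_i.
Proof.
rewrite /qform raddf_sum /= (bigD1 i) //= big1 => [|j ne_ji].
  by rewrite mderiv_exp mderiv_var eqxx addr0 expr1 mulr1.
by rewrite mderiv_exp mderiv_var (negPf ne_ji) mulr0.
Qed.

Fact laplacian_is_linear : linear (@laplacian K n).
Proof.
move=> c p r; rewrite /laplacian scaler_sumr -big_split /=.
by apply: eq_bigr => i _; rewrite !linearP.
Qed.
HB.instance Definition _ :=
  GRing.isLinear.Build K {mpoly K[n]} {mpoly K[n]} _ (@laplacian K n) laplacian_is_linear.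

Lemma laplacian_linform a k :
  laplacian (linform a ^+ k.+2) =
  ((k.+2 * k.+1)%:R * dot a a) *: linform a ^+ k.
Proof.
rewrite /laplacian -mul_mpolyC rmorphM rmorph_nat /dot raddf_sum /= mulr_sumr mulr_suml.
apply: eq_bigr => i _.
rewrite mderiv_exp mderiv_linform mulrC mderiv_mulC mulr_natl mderivMn.
rewrite mderiv_exp mderiv_linform mpolyCM natrM -mulr_natl; ring.
Qed.

(** Euler's identity for the form q^k, homogeneous of degree 2k. *)
Lemma euler_qform k :
  \sum_(i < n) (qform K n ^+ k)^`M(i) * 'X_i = (2 * k)%:R * qform K n ^+ k.
Proof.
case: k => [|k].
  by rewrite muln0 mul0r big1 // => i _; rewrite expr0 -mpolyC1 mderivC mul0r.
rewrite [RHS](_ : _ = (2 * k.+1)%:R * qform K n ^+ k * qform K n); last first.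
  by rewrite exprSr mulrA.
rewrite [X in _ = _ * X]/qform mulr_sumr; apply: eq_bigr => i _.
by rewrite mderiv_exp mderiv_qform natrM; ring.
Qed.

Lemma laplacian_qform k :
  laplacian (qform K n ^+ k.+1) =
  (2 * k.+1 * (2 * k + n))%:R *: qform K n ^+ k.
Proof.
have D2 i : (qform K n ^+ k.+1)^`M(i)^`M(i) =
    (2 * k.+1)%:R * ((qform K n ^+ k)^`M(i) * 'X_i + qform K n ^+ k).
  rewrite mderiv_exp mderiv_qform.
  rewrite (_ : _ * _ * _ = (qform K n ^+ k * 'X_i) *+ (2 * k.+1)); last first.
    by rewrite -[RHS]mulr_natl natrM; ring.
  rewrite mderivMn mderivM mderiv_var eqxx mulr1.
  by rewrite mulr_natl.
rewrite /laplacian (eq_bigr _ (fun i _ => D2 i)) -mulr_sumr big_split /=.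
rewrite euler_qform sumr_const card_ord scaler_nat natrM.
by rewrite -[_ *+ n]mulr_natl -[RHS]mulr_natl !(natrM, natrD); ring.
Qed.
End Laplacian.

(** Each Laplacian lowers the degree by two and turns (a.x)^(2t+2) into
    (2t+2)(2t+1) q(a) (a.x)^(2t), and q^(t+1) into 2(t+1)(2t+n) q^t; the
    factor (2t+n)/(2t+1) of the product is the ratio of these constants. *)
Lemma moments (K : numFieldType) (n s m : nat) (a : 'I_m -> 'rV[K]_n) j t :
    decomposition s a -> (j + t = s)%N ->
  \sum_(k < m) dot (a k) (a k) ^+ j *: linform (a k) ^+ (2 * t) =
  (\prod_(t <= i < s) ((2 * i + n)%:R / (2 * i + 1)%:R)) *: qform K n ^+ t.
Proof.
move=> dec; elim: j t => [|j IHj] t.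
  rewrite add0n => ->; rewrite big_geq // scale1r dec.
  by apply: eq_bigr => k _; rewrite expr0 scale1r.
move=> jts; have := congr1 (@laplacian _ n) (IHj t.+1 _).
rewrite linearZ raddf_sum /= addnS -addSn => /(_ jts).
rewrite laplacian_qform (@big_ltn _ _ _ t) ?scalerA; last by lia.
set g := \prod_(t.+1 <= i < s) _.
have nz1 : (2 * t + 1)%:R != 0 :> K by rewrite pnatr_eq0; lia.
have nz2 : (2 * t + 2)%:R != 0 :> K by rewrite pnatr_eq0; lia.
rewrite (_ : \sum_(k < m) _ = ((2 * t + 2) * (2 * t + 1))%:R *:
    \sum_(k < m) dot (a k) (a k) ^+ j.+1 *: linform (a k) ^+ (2 * t)); last first.
  rewrite scaler_sumr; apply: eq_bigr => k _ /=.
  rewrite linearZ /= (_ : 2 * t.+1 = (2 * t).+2)%N; last by lia.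
  rewrite laplacian_linform !scalerA; congr (_ *: _).
  by rewrite addn2 addn1 exprSr; ring.
move/(congr1 (fun p => ((2 * t + 2) * (2 * t + 1))%:R^-1 *: p)).
rewrite !scalerA mulVf ?scale1r => [->|]; last by rewrite natrM mulf_neq0.
congr (_ *: _); rewrite -/g natrM (_ : 2 * t.+1 = 2 * t + 2)%N; last by lia.
rewrite natrM; field.
by move: nz1 nz2; rewrite !(natrM, natrD) => -> ->.
Qed.

(** * Polynomials as functions on points and on lines *)

Lemma poly0_nat_roots (L : idomainType) (p : {poly L}) :
  injective (fun k : nat => k%:R : L) -> (forall k : nat, p.[k%:R] = 0) -> p = 0.
Proof.
move=> natr_inj p0; apply/eqP; apply: contraT => nz_p.
have := max_poly_roots nz_p (rs := [seq k%:R | k <- iota 0 (size p)]).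
rewrite map_inj_uniq ?iota_uniq // size_map size_iota ltnn.
by move=> -> //; apply/allP => _ /mapP[k _ ->]; rewrite rootE p0.
Qed.

Lemma horner_mmap (K : comNzRingType) n (h : 'I_n -> {poly {mpoly K[n]}}) z p :
  (mmap (polyC \o @mpolyC n K) h p).[z] = mmap (@mpolyC n K) (fun i => (h i).[z]) p.
Proof.
rewrite /mmap horner_sum; apply: eq_bigr => mu _.
rewrite hornerM /= hornerC /mmap1 horner_prod.
by congr (_ * _); apply: eq_bigr => i _; rewrite horner_exp.
Qed.

(** The variables are substituted one at a time: [h k v] keeps the first k
    variables and evaluates the others at v.  Passing from k to k + 1 views the
    result as a univariate polynomial in the k-th variable, with coefficients in
    the integral domain of multivariate polynomials, having every natural number
    as a root. *)
Lemma mpoly_eq0_eval (K : numFieldType) n (p : {mpoly K[n]}) :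
  (forall v, p.@[v] = 0) -> p = 0.
Proof.
move=> p0.
pose h k (v : 'I_n -> K) (i : 'I_n) := if (i < k)%N then 'X_i else (v i)%:MP_[n].
have eq_mmap h1 h2 : h1 =1 h2 -> mmap (@mpolyC n K) h1 p = mmap (@mpolyC n K) h2 p.
  by move=> eq_h; apply: eq_bigr => mu _; congr (_ * _); apply: mmap1_eq.
have vanish k v : mmap (@mpolyC n K) (h k v) p = 0.
  elim: k v => [|k IHk] v.
    rewrite -[RHS](@mpolyC0 n K) -(p0 v) /meval /mmap raddf_sum.
    apply: eq_bigr => mu _ /=; rewrite mpolyCM /mmap1 rmorph_prod.
    by congr (_ * _); apply: eq_bigr => i _; rewrite rmorphXn.
  have [lt_kn | le_nk] := ltnP k n; last first.
    rewrite -(IHk v); apply: eq_mmap => i.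
    by rewrite /h !(leq_trans (ltn_ord i)) // leqW.
  pose H (i : 'I_n) : {poly {mpoly K[n]}} :=
    if (i < k)%N then ('X_i)%:P else if i == k :> nat then 'X else ((v i)%:MP)%:P.
  have H0 : mmap (polyC \o @mpolyC n K) H p = 0.
    apply: poly0_nat_roots => [c d|c].
      by rewrite -!mpolyC_nat => /eqP; rewrite mpolyC_eq eqr_nat => /eqP.
    pose w (i : 'I_n) := if i == k :> nat then c%:R else v i.
    rewrite horner_mmap -(IHk w); apply: eq_mmap => i; rewrite /H /h /w.
    case: ltnP => _; rewrite ?hornerC //.
    by case: eqP => _; rewrite ?hornerX ?hornerC ?mpolyC_nat.
  have := congr1 (fun P : {poly _} => P.['X_(Ordinal lt_kn)]) H0.
  rewrite /= horner0 horner_mmap => <-; apply: eq_mmap => i.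
  rewrite /h /H ltnS leq_eqVlt orbC; case: ltnP => _ /=; rewrite ?hornerC //.
  case: eqP => [eq_ik|_]; rewrite ?hornerX ?hornerC //.
  by congr 'X_(_); apply: val_inj.
rewrite -(comp_mpoly_id p) -(vanish n (fun=> 0)); apply: eq_mmap => i.
by rewrite /h ltn_ord tnth_map tnth_ord_tuple.
Qed.

Lemma mpoly_eval_inj (K : numFieldType) n (p q : {mpoly K[n]}) :
  (forall x : 'rV[K]_n, p.@[x 0] = q.@[x 0]) -> p = q.
Proof.
move=> eq_pq; apply/eqP; rewrite -subr_eq0; apply/eqP/mpoly_eq0_eval => v.
have to_row r : r.@[v] = r.@[(\row_i v i) 0].
  by apply: meval_eq => i; rewrite mxE.
by rewrite mevalB !to_row eq_pq subrr.
Qed.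

Section Evaluation.
Variables (K : comNzRingType) (n : nat).
Implicit Types (a x y : 'rV[K]_n).

Lemma dotC x y : dot x y = dot y x.
Proof. by apply: eq_bigr => i _; rewrite mulrC. Qed.

Lemma meval_linform a x : (linform a).@[x 0] = dot a x.
Proof.
by rewrite raddf_sum; apply: eq_bigr => i _ /=; rewrite mevalZ mevalXU.
Qed.

(** Restriction of a polynomial to the parametrized line x + u y, with u the
    variable of the univariate result. *)
Definition on_line x y : {mpoly K[n]} -> {poly K} :=
  mmap polyC (fun i => (x 0 i)%:P + (y 0 i)%:P * 'X).
HB.instance Definition _ x y := GRing.RMorphism.on (on_line x y).

Lemma on_lineZ x y c p : on_line x y (c *: p) = c%:P * on_line x y p.
Proof. exact: mmapZ. Qed.

Lemma on_line_var x y i : on_line x y 'X_i = (x 0 i)%:P + (y 0 i)%:P * 'X.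
Proof. by rewrite /on_line mmapX mmap1U. Qed.

Lemma on_line_linform x y a :
  on_line x y (linform a) = (dot a x)%:P + (dot a y)%:P * 'X.
Proof.
rewrite /linform /dot !raddf_sum mulr_suml -big_split; apply: eq_bigr => i _ /=.
by rewrite on_lineZ on_line_var !polyCM; ring.
Qed.

Lemma on_line_qform x y :
  on_line x y (qform K n) =
  (dot y y)%:P * 'X^2 + ((dot x x)%:P + (2%:R * dot x y)%:P * 'X).
Proof.
rewrite /qform /dot !(mulr_sumr, raddf_sum) !mulr_suml -!big_split.
apply: eq_bigr => i _ /=.
by rewrite rmorphXn /= on_line_var !polyCM polyC_natr; ring.
Qed.

Lemma coef_linear_exp (b c : K) t r :
  ((b%:P + c%:P * 'X) ^+ t)`_r = b ^+ (t - r) * c ^+ r *+ 'C(t, r).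
Proof.
rewrite exprDn coef_sum.
under eq_bigr => i _ do
  rewrite coefMn exprMn -!polyC_exp mulrA -polyCM coefCM coefXn mulr_natr.
have [le_rt | lt_tr] := leqP r t; last first.
  rewrite bin_small // mulr0n big1 // => i _.
  by rewrite gtn_eqF ?mul0rn // (leq_ltn_trans _ lt_tr) // -ltnS.
rewrite (bigD1 (Ordinal (le_rt : (r < t.+1)%N))) //= eqxx big1 ?addr0 // => i.
by rewrite -val_eqE /= eq_sym => /negPf ->; rewrite mul0rn.
Qed.

Lemma coef_quadratic_exp (b c d : K) t r :
  ((d%:P * 'X^2 + (b%:P + c%:P * 'X)) ^+ t)`_r =
  \sum_(i < t.+1 | (2 * i <= r)%N)
    (b ^+ (t - i - (r - 2 * i)) * c ^+ (r - 2 * i) * d ^+ i)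
      *+ ('C(t - i, r - 2 * i) * 'C(t, i)).
Proof.
rewrite addrC exprDn coef_sum [RHS]big_mkcond; apply: eq_bigr => i _.
rewrite coefMn exprMn -polyC_exp -exprM mulrCA coefCM coefMXn ltnNge.
case: leqP => _; last by rewrite mulr0 mul0rn.
by rewrite coef_linear_exp mulrnA mulrnAr mulrC.
Qed.
End Evaluation.

(** * Zonal kernels *)

(** The constant c must serve all y at once: this is what makes the powers
    q(a_k)^s equal to one another in the end. *)
Definition zonal_expansion (K : comNzRingType) n s m (a : 'I_m -> 'rV[K]_n)
    (Phi : 'rV[K]_n -> 'rV[K]_n -> K) : Prop :=
  exists c (P : 'rV[K]_n -> 'rV[K]_n -> K),
    (forall y, P y y = c * dot y y ^+ s) /\
    (forall x y, Phi x y = \sum_(k < m) dot (a k) x ^+ s * P y (a k)).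

Section ZonalExpansion.
Variables (K : numFieldType) (n s m : nat) (a : 'I_m -> 'rV[K]_n).
Implicit Types Phi Psi : 'rV[K]_n -> 'rV[K]_n -> K.
Local Notation zonal := (zonal_expansion s a).

Lemma zonal_ext Phi Psi : (forall x y, Phi x y = Psi x y) -> zonal Phi -> zonal Psi.
Proof.
by move=> eqPP [c [P [Pd PE]]]; exists c, P; split=> // x y; rewrite -eqPP.
Qed.

Lemma zonal_lin b Phi Psi : zonal Phi -> zonal Psi ->
  zonal (fun x y => b * Phi x y + Psi x y).
Proof.
move=> [c [P [Pd PE]]] [c' [P' [Pd' PE']]].
exists (b * c + c'), (fun y z => b * P y z + P' y z); split=> [y|x y].
  by rewrite Pd Pd'; ring.
rewrite PE PE' mulr_sumr -big_split; apply: eq_bigr => k _ /=; ring.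
Qed.

Lemma zonal0 : zonal (fun _ _ => 0).
Proof.
exists 0, (fun _ _ => 0); split=> [y|x y]; first by rewrite mul0r.
by rewrite big1 // => k _; rewrite mulr0.
Qed.

Lemma zonal_sum (I : Type) (r : seq I) (Q : pred I) (b : I -> K) F :
    (forall i, Q i -> zonal (F i)) ->
  zonal (fun x y => \sum_(i <- r | Q i) b i * F i x y).
Proof.
move=> zF; elim: r => [|i r IHr].
  by apply: zonal_ext zonal0 => x y; rewrite big_nil.
have [Qi | nQi] := boolP (Q i); last first.
  by apply: zonal_ext IHr => x y; rewrite big_cons (negPf nQi).
by apply: zonal_ext (zonal_lin (b i) (zF i Qi) IHr) => x y; rewrite big_cons Qi.
Qed.

Definition zonal_monomial j (x y : 'rV[K]_n) :=
  dot x y ^+ (s - 2 * j) * (dot x x * dot y y) ^+ j.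

Hypotheses (n_gt0 : (0 < n)%N) (dec : decomposition s a).

(** The coefficient of u^(s-2j) on the line x + u y in the moment of order j.
    The degree 2(s-j) leaves the power s for a_k.x; multiplying by q(y)^j gives
    total degree s in y, so that the diagonal becomes a multiple of q(y)^s. *)
Lemma zonal_relation j x y : (2 * j <= s)%N ->
  'C(2 * (s - j), s - 2 * j)%:R *
    \sum_(k < m) dot (a k) x ^+ s *
      ((dot y y * dot (a k) (a k)) ^+ j * dot (a k) y ^+ (s - 2 * j)) =
  (\prod_(s - j <= i < s) ((2 * i + n)%:R / (2 * i + 1)%:R)) *
  \sum_(i < (s - j).+1 | (2 * i <= s - 2 * j)%N)
    (2%:R ^+ (s - 2 * j - 2 * i)
      *+ ('C(s - j - i, s - 2 * j - 2 * i) * 'C(s - j, i))) *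
    zonal_monomial (j + i) x y.
Proof.
move=> le_js; have js : (j + (s - j) = s)%N by lia.
have := congr1 (fun p => dot y y ^+ j * (on_line x y p)`_(s - 2 * j)) (moments dec js).
rewrite /= on_lineZ coefCM rmorphXn /= on_line_qform coef_quadratic_exp => e.
transitivity (dot y y ^+ j *
  (on_line x y (\sum_(k < m) dot (a k) (a k) ^+ j *: linform (a k) ^+ (2 * (s - j))))`_(s - 2 * j)).
  rewrite raddf_sum coef_sum !mulr_sumr; apply: eq_bigr => k _ /=.
  rewrite on_lineZ coefCM rmorphXn /= on_line_linform coef_linear_exp.
  rewrite (_ : 2 * (s - j) - (s - 2 * j) = s)%N; last by lia.
  by rewrite -[_ *+ 'C(_, _)]mulr_natl exprMn; ring.
rewrite {}e mulrCA; congr (_ * _); rewrite mulr_sumr; apply: eq_bigr => i le_i.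
rewrite /zonal_monomial (_ : s - 2 * (j + i) = s - 2 * j - 2 * i)%N; last by lia.
rewrite (_ : s - j - i - _ = j + i)%N; last by lia.
by rewrite -[_ *+ _ in LHS]mulr_natl -[_ *+ _ in RHS]mulr_natl !exprMn !exprD; ring.
Qed.

(** The relation of index j involves the monomials of index at least j, and
    the one of index j with a nonzero coefficient, so it expresses that monomial
    through an explicit expansion and the monomials of larger index. *)
Lemma zonal_monomialP j : (2 * j <= s)%N -> zonal (zonal_monomial j).
Proof.
have [d le_d] := ubnP (s - 2 * j); elim: d j le_d => // d IHd j lt_d le_js.
set g := \prod_(s - j <= i < s) ((2 * i + n)%:R / (2 * i + 1)%:R) : K.
pose b i : K := 2%:R ^+ (s - 2 * j - 2 * i)
  *+ ('C(s - j - i, s - 2 * j - 2 * i) * 'C(s - j, i)).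
have nz_g : g != 0.
  rewrite prodf_seq_neq0; apply/allP => i _ /=; rewrite mulf_neq0 // ?invr_eq0 pnatr_eq0; lia.
have nz_b : b 0%N != 0.
  rewrite /b muln0 !subn0 bin0 muln1 mulrn_eq0 negb_or expf_neq0 ?pnatr_eq0 //.
  by rewrite -lt0n bin_gt0; lia.
(* On the diagonal z = y all three factors of the kernel are powers of q(y). *)
have zS : zonal (fun x y => \sum_(k < m) dot (a k) x ^+ s *
      ((dot y y * dot (a k) (a k)) ^+ j * dot (a k) y ^+ (s - 2 * j))).
  exists 1, (fun y z => (dot y y * dot z z) ^+ j * dot z y ^+ (s - 2 * j)).
  split=> // y; rewrite exprMn -!exprD mul1r; congr (_ ^+ _); lia.
have zT : zonal (fun x y =>
    \sum_(i < (s - j).+1 | (2 * i <= s - 2 * j)%N && (i != ord0))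
      b i * zonal_monomial (j + i) x y).
  apply: zonal_sum => i /andP[le_i]; rewrite -val_eqE /= => ne_i0.
  apply: IHd; lia.
have zC := zonal_lin ('C(2 * (s - j), s - 2 * j)%:R / g) zS (zonal_lin (-1) zT zonal0).
apply: zonal_ext (zonal_lin (b 0%N)^-1 zC zonal0) => x y.
apply: (mulfI nz_b); rewrite addr0 mulVKf // addr0.
apply: (mulfI nz_g); rewrite [LHS]mulrDr [g * (_ * _)]mulrA [g * (_ / g)]mulrC divfK //.
rewrite (zonal_relation x y le_js) -/g (bigD1 ord0) //= addn0.
by rewrite /b muln0 !subn0; ring.
Qed.
End ZonalExpansion.

(** * Evaluation of forms at the points of a tight decomposition *)

Lemma mderivm_linform (K : comNzRingType) n (a : 'rV[K]_n) (mu : 'X_{1..n}) :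
  (linform a ^+ mdeg mu)^`M[mu] = ((mdeg mu)`!%:R * 'X_[mu].@[a 0])%:MP.
Proof.
move: {-1}(mdeg mu) (erefl (mdeg mu)) => d; elim: d mu => [|d IHd] mu deg_mu.
  have /eqP : mdeg mu == 0%N by rewrite deg_mu.
  move/eqP; rewrite mdeg_eq0 => /eqP ->.
  by rewrite mderivm0m mpolyX0 meval1 expr0 mulr1.
have [i mu_i] : exists i, (0 < mu i)%N.
  apply/existsP; apply: contraT; rewrite negb_exists => /forallP mu0.
  suff : mdeg mu = 0%N by rewrite deg_mu.
  by rewrite mdegE big1 // => i _; apply/eqP; move: (mu0 i); rewrite -eqn0Ngt.
have def_mu : mu = (U_(i) + (mu - U_(i)))%MM.
  by apply/mnmP => j; rewrite mnmDE mnmBE mnm1E; case: eqP => [<-|_]; lia.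
have deg_nu : mdeg (mu - U_(i))%MM = d.
  by move: deg_mu; rewrite {1}def_mu mdegD mdeg1 add1n => -[].
rewrite def_mu mderivmDm mderivmU1m mderiv_exp mderiv_linform -def_mu mulrC.
rewrite mulrA mulr_natr -mpolyCMn mderivm_mulC (IHd _ deg_nu) -mpolyCM.
by rewrite [in RHS]def_mu mpolyXD mevalM mevalXU factS natrM -mulr_natr; congr _%:MP; ring.
Qed.

(** Applying the differential operator of a monomial of degree s to the
    s-th power of the linear form a.x evaluates that monomial at a, up to the
    factor s!.  This turns the expansion of (x.y)^s, as a form in x, into an
    interpolation formula. *)
Lemma monomial_reproduction (K : numFieldType) n s m (a : 'I_m -> 'rV[K]_n)
    (P : 'rV[K]_n -> 'rV[K]_n -> K) (mu : 'X_{1..n}) :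
    (forall x y, dot x y ^+ s = \sum_(k < m) dot (a k) x ^+ s * P y (a k)) ->
    mdeg mu = s ->
  forall y : 'rV[K]_n, 'X_[mu].@[y 0] = \sum_(k < m) P y (a k) * 'X_[mu].@[a k 0].
Proof.
move=> PE deg_mu y.
have : linform y ^+ s = \sum_(k < m) P y (a k) *: linform (a k) ^+ s.
  apply: mpoly_eval_inj => x; rewrite rmorphXn /= meval_linform dotC PE raddf_sum.
  by apply: eq_bigr => k _ /=; rewrite mevalZ rmorphXn /= meval_linform mulrC.
move/(congr1 (mderivm mu)); rewrite raddf_sum -deg_mu mderivm_linform /=.
under eq_bigr => k _ do rewrite mderivmZ mderivm_linform -mul_mpolyC -mpolyCM mulrCA mpolyCM.
rewrite -mulr_sumr mpolyCM -raddf_sum => /eqP; rewrite -!mpolyCM mpolyC_eq => /eqP.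
by apply: mulfI; rewrite pnatr_eq0 -lt0n fact_gt0.
Qed.

Lemma monomial_enum n s :
  exists mu : 'I_(Tnum n.+1 s) -> 'X_{1..n.+1},
    injective mu /\ forall j, mdeg (mu j) = s.
Proof.
pose B := [seq s2m t | t : s.-tuple 'I_n.+1 <- enum (basis n.+1 s)].
have szB : size B = Tnum n.+1 s.
  by rewrite size_basis /Tnum addnS subn1.
exists (fun j => nth 0%MM B j); split=> [i j /eqP|j].
  by rewrite nth_uniq ?uniq_basis ?szB // => /eqP/val_inj.
by apply/eqP; rewrite basis_cover mem_nth ?szB.
Qed.

(** By the interpolation formula, a form of degree s is determined by its
    values at the a_k.  The evaluation matrix of the monomials of degree s is
    square exactly because the decomposition is tight, so it is invertible and
    a form dual to each a_l exists. *)
Lemma tight_diagonal (K : numFieldType) n s (a : 'I_(Tnum n.+1 s) -> 'rV[K]_n.+1)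
    (P : 'rV[K]_n.+1 -> 'rV[K]_n.+1 -> K) :
    (forall x y, dot x y ^+ s =
       \sum_(k < Tnum n.+1 s) dot (a k) x ^+ s * P y (a k)) ->
  forall l, P (a l) (a l) = 1.
Proof.
move=> PE l; have [mu [mu_inj deg_mu]] := monomial_enum n s.
pose E : 'M[K]_(Tnum n.+1 s) := \matrix_(j, k) 'X_[mu j].@[a k 0].
pose f (e : 'rV[K]_(Tnum n.+1 s)) : {mpoly K[n.+1]} := \sum_j e 0 j *: 'X_[mu j].
have feval e (y : 'rV[K]_n.+1) : (f e).@[y 0] = \sum_j e 0 j * 'X_[mu j].@[y 0].
  by rewrite raddf_sum; apply: eq_bigr => j _ /=; rewrite mevalZ.
have f_rep e (y : 'rV[K]_n.+1) : (f e).@[y 0] = \sum_k P y (a k) * (e *m E) 0 k.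
  rewrite feval.
  under eq_bigr => j _ do rewrite (monomial_reproduction PE (deg_mu j)) mulr_sumr.
  rewrite exchange_big; apply: eq_bigr => k _; rewrite mxE mulr_sumr.
  by apply: eq_bigr => j _; rewrite mxE mulrCA.
have E_unit : E \in unitmx.
  rewrite unitmxE unitfE; apply/negP => /eqP/eqP/det0P[e nz_e eE0].
  case/negP: nz_e; apply/eqP/rowP => j; rewrite mxE.
  have f0 : f e = 0.
    apply: mpoly_eval_inj => y; rewrite f_rep eE0 meval0 big1 // => k _.
    by rewrite mxE mulr0.
  have := congr1 (mcoeff (mu j)) f0; rewrite mcoeff0 raddf_sum (bigD1 j) //=.
  rewrite mcoeffZ mcoeffX eqxx mulr1 big1 ?addr0 // => i ne_ij.
  by rewrite mcoeffZ mcoeffX (inj_eq mu_inj) (negPf ne_ij) mulr0.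
(* [f e] is the form that takes the value 1 at a_l and 0 at the other points. *)
pose e := delta_mx 0 l *m invmx E : 'rV[K]_(Tnum n.+1 s).
have eE : e *m E = delta_mx 0 l by rewrite mulmxKV.
have : (f e).@[a l 0] = (e *m E) 0 l.
  by rewrite [RHS]mxE feval; apply: eq_bigr => j _; rewrite [E _ _]mxE.
rewrite f_rep eE (bigD1 l) //= !mxE !eqxx mulr1 big1 ?addr0 // => k ne_kl.
by rewrite mxE (negPf ne_kl) andbF mulr0.
Qed.

Unset Implicit Arguments.

Theorem theorem4p15 (R : realType) (n s : nat) (hn : (1 <= n)%N) (hs : (1 <= s)%N)
    (m : nat) (a : 'I_m -> 'rV[R[i]]_n) (ha : tight_decomposition s a) :
  first_caliber s a /\
  forall k : 'I_m,
    dot (a k) (a k) ^+ s =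
      (Tnum n s)%:R^-1 * \prod_(0 <= j < s) ((2 * j + n)%:R / (2 * j + 1)%:R).
Proof.
case: ha => dec def_m; case: n hn a dec def_m => // n hn a dec def_m.
move: a dec; rewrite {m}def_m => a dec.
have [c [P [Pdiag PE]]] := @zonal_monomialP _ _ _ _ a hn dec 0%N (leq0n s).
have unit_diag : forall l, c * dot (a l) (a l) ^+ s = 1.
  move=> l; rewrite -Pdiag; apply: (tight_diagonal (a := a)) => x y.
  by rewrite -PE /zonal_monomial muln0 subn0 expr0 mulr1.
have norm_const l : dot (a l) (a l) ^+ s = c^-1.
  have nz_c : c != 0.
    apply/eqP => c0; have := unit_diag l.
    by rewrite c0 mul0r => /esym/eqP; rewrite oner_eq0.
  by rewrite -[LHS](mulKf nz_c) unit_diag mulr1.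
split=> [k l|k]; first by rewrite !norm_const.
have := congr1 (meval (a k 0)) (moments dec (addn0 s)).
rewrite muln0 expr0 mevalZ meval1 mulr1 => <-; rewrite raddf_sum /=.
under eq_bigr => l _ do rewrite mevalZ expr0 meval1 mulr1 norm_const.
rewrite sumr_const card_ord norm_const -[c^-1 *+ _]mulr_natl mulKf //.
by rewrite pnatr_eq0 -lt0n bin_gt0; lia.
Qed.
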